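(* Let $\mathscr{D}$ be a triangulated category with a t-structure $\tau=({}^{\tau}\mathscr{D}^{\le 0},{}^{\tau}\mathscr{D}^{\ge 0})$. Let $\mathscr{C}$ be a triangulated category with a fully faithful triangulated functor $\gamma\colon\mathscr{C}\to\mathscr{D}$. Assume that $\gamma$ admits a right adjoint $\gamma^!\colon\mathscr{D}\to\mathscr{C}$ and that the composition $\gamma\circ\gamma^!$ is right t-exactable with respect to $\tau$, with right $\gamma\gamma^!$-perverse t-structure $\tau_{\gamma\gamma^!}^{-}$. Then $\tau$ connectively induces a t-structure $\tau_{\mathscr{C}}^{-}$ on $\mathscr{C}$ such that the following properties hold: (1) The t-structure $\tau_{\gamma\gamma^!}^{-}$ right projects to a t-structure $\gamma^!(\tau_{\gamma\gamma^!}^{-})$ on $\mathscr{C}$ which coincides with $\tau_{\mathscr{C}}^{-}$. (2) The heart of $\tau_{\mathscr{C}}^{-}$ and the subcategories of bounded objects are given by ${}^{\tau_{\mathscr{C}}^{-}}\mathscr{C}^{\heartsuit}=\gamma^!\big({}^{\tau_{\gamma\gamma^!}^{-}}\mathscr{D}^{\heartsuit}\big)$ and ${}^{\tau_{\mathscr{C}}^{-}}\mathscr{C}^{?}=\gamma^!\big({}^{\tau_{\gamma\gamma^!}^{-}}\mathscr{D}^{?}\big)$ for $?\in\{+,-,\mathrm{b}\}$. (3) $\gamma^!$ is t-exact with respect to $\tau_{\gamma\gamma^!}^{-}$ and $\tau_{\mathscr{C}}^{-}$. (4) $\gamma$ is right t-exact with respect to $\tau_{\mathscr{C}}^{-}$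 and $\tau_{\gamma\gamma^!}^{-}$. (5) Assume that $\tau$ is bounded and $\gamma\circ\gamma^!$ has finite right t-amplitude with respect to $\tau$. Then $\tau_{\gamma\gamma^!}^{-}$ and $\tau_{\mathscr{C}}^{-}$ are bounded.
   Context: For a t-structure $\tau$ put ${}^{\tau}\mathscr{D}^{\le n}={}^{\tau}\mathscr{D}^{\le 0}[-n]$, ${}^{\tau}\mathscr{D}^{\ge n}={}^{\tau}\mathscr{D}^{\ge 0}[-n]$, heart ${}^{\tau}\mathscr{D}^{\heartsuit}={}^{\tau}\mathscr{D}^{\le 0}\cap{}^{\tau}\mathscr{D}^{\ge 0}$, ${}^{\tau}\mathscr{D}^{+}=\bigcup_n{}^{\tau}\mathscr{D}^{\ge n}$, ${}^{\tau}\mathscr{D}^{-}=\bigcup_n{}^{\tau}\mathscr{D}^{\le n}$, ${}^{\tau}\mathscr{D}^{\mathrm{b}}={}^{\tau}\mathscr{D}^{+}\cap{}^{\tau}\mathscr{D}^{-}$; $\tau$ is bounded if $\mathscr{D}={}^{\tau}\mathscr{D}^{\mathrm{b}}$. ${}^{\tau}\mathscr{D}^{\le 0}$ and ${}^{\tau}\mathscr{D}^{\ge 0}$ are the connective and coconnective parts. A triangulated functor is right (left) t-exact if it preserves connective (coconnective) parts, t-exact if both. An endofunctor $\Phi$ has right t-amplitude $\le b$ with respect to $\tau$ if $\Phi({}^{\tau}\mathscr{D}^{\le 0})\subset{}^{\tau}\mathscr{D}^{\le b}$, and finite right t-amplitude if this holds for some integer $b$. A triangulated endofunctor $\Phi\colon\mathscr{D}\to\mathscr{D}$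 is idempotent if $\Phi^2\simeq\Phi$ (e.g. $\gamma\circ\gamma^!$). An idempotent $\Phi$ is right t-exactable with respect to $\tau$ if the pair $\tau_{\Phi}^{-}$ consisting of $${}^{\tau_{\Phi}^{-}}\mathscr{D}^{\le 0}=\{D\in{}^{\tau}\mathscr{D}^{\le 0}:\Phi(D)\in{}^{\tau}\mathscr{D}^{\le 0}\},\qquad {}^{\tau_{\Phi}^{-}}\mathscr{D}^{\ge 0}=\{D\in\mathscr{D}:\mathrm{Hom}(D'[1],D)=0\ \forall D'\in{}^{\tau_{\Phi}^{-}}\mathscr{D}^{\le 0}\}$$ is a t-structure on $\mathscr{D}$; it is then called the right $\Phi$-perverse t-structure. A t-structure $\upsilon$ on $\mathscr{D}$ right projects to a t-structure on $\mathscr{C}$ if the pair of essential images $\gamma^!\upsilon=(\gamma^!({}^{\upsilon}\mathscr{D}^{\le 0}),\gamma^!({}^{\upsilon}\mathscr{D}^{\ge 0}))$ is a t-structure on $\mathscr{C}$. $\tau$ connectively induces a t-structure on $\mathscr{C}$ if $\tau_{\mathscr{C}}^{-}=(\mathscr{C}^{\le 0},\mathscr{C}^{\ge 0})$ with $\mathscr{C}^{\le 0}=\{C\in\mathscr{C}:\gamma(C)\in{}^{\tau}\mathscr{D}^{\le 0}\}$ and $\mathscr{C}^{\ge 0}=\{C\in\mathscr{C}:\mathrm{Hom}(C'[1],C)=0\ \forall C'\in\mathscr{C}^{\le 0}\}$ is a t-structure on $\mathscr{C}$. *)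

(* Defs.v *)
From HB Require Import structures.
From mathcomp Require Import all_boot all_algebra.
From mathcomp Require Import boolp classical_sets.

Set Implicit Arguments.
Unset Strict Implicit.
Unset Printing Implicit Defensive.

Import GRing.Theory.
Local Open Scope classical_set_scope.
Local Open Scope ring_scope.

Reserved Notation "g \oc f" (at level 40, left associativity).
Reserved Notation "X \iso Y" (at level 70, no associativity).

(* Preadditive categories; [g \oc f] is "f, then g". *)
Record category := Category {
  ob :> Type;
  hom : ob -> ob -> zmodType;
  idc : forall X, hom X X;
  comp : forall X Y Z, hom Y Z -> hom X Y -> hom X Z;
  compA : forall X Y Z W (h : hom Z W) (g : hom Y Z) (f : hom X Y),
    comp h (comp g f) = comp (comp h g) f;
  comp1c : forall X Y (f : hom X Y), comp (idc Y) f = f;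
  compc1 : forall X Y (f : hom X Y), comp f (idc X) = f;
  compDl : forall X Y Z (g1 g2 : hom Y Z) (f : hom X Y),
    comp (g1 + g2) f = comp g1 f + comp g2 f;
  compDr : forall X Y Z (g : hom Y Z) (f1 f2 : hom X Y),
    comp g (f1 + f2) = comp g f1 + comp g f2
}.
Arguments hom {c} X Y.
Arguments idc {c} X.
Arguments comp {c X Y Z} g f.
Notation "g \oc f" := (comp g f) : ring_scope.

Definition is_iso (C : category) (X Y : C) (f : hom X Y) : Prop :=
  exists g : hom Y X, g \oc f = idc X /\ f \oc g = idc Y.

Definition isomorphic (C : category) (X Y : C) : Prop :=
  exists f : hom X Y, is_iso f.
Notation "X \iso Y" := (isomorphic X Y) : ring_scope.

Definition is_zero_ob (C : category) (X : C) : Prop := idc X = 0.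

Definition is_biproduct (C : category) (X Y P : C)
    (i1 : hom X P) (i2 : hom Y P) (p1 : hom P X) (p2 : hom P Y) : Prop :=
  [/\ p1 \oc i1 = idc X, p2 \oc i2 = idc Y, p1 \oc i2 = 0, p2 \oc i1 = 0
    & i1 \oc p1 + i2 \oc p2 = idc P].

(* Functors are not assumed additive; additivity is [additive_functor]. *)
Record functor (C D : category) := Functor {
  fob :> C -> D;
  fmap : forall X Y : C, hom X Y -> hom (fob X) (fob Y);
  fmap_id : forall X, fmap (idc X) = idc (fob X);
  fmap_comp : forall X Y Z (g : hom Y Z) (f : hom X Y),
    fmap (g \oc f) = fmap g \oc fmap f
}.
Arguments fmap {C D} _ {X Y} _.

Definition additive_functor (C D : category) (F : functor C D) : Prop :=
  forall (X Y : C) (f g : hom X Y), fmap F (f + g) = fmap F f + fmap F g.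

Definition id_functor (C : category) : functor C C :=
  @Functor C C (fun X => X) (fun X Y f => f)
    (fun X => erefl) (fun X Y Z g f => erefl).

Lemma comp_functor_id (A B C : category) (G : functor B C) (F : functor A B)
  (X : A) : fmap G (fmap F (idc X)) = idc (G (F X)).
Proof. by rewrite !fmap_id. Qed.

Lemma comp_functor_comp (A B C : category) (G : functor B C)
    (F : functor A B) (X Y Z : A) (g : hom Y Z) (f : hom X Y) :
  fmap G (fmap F (g \oc f)) = fmap G (fmap F g) \oc fmap G (fmap F f).
Proof. by rewrite !fmap_comp. Qed.

Definition comp_functor (A B C : category) (G : functor B C)
    (F : functor A B) : functor A C :=
  @Functor A C (fun X => G (F X)) (fun X Y f => fmap G (fmap F f))
    (comp_functor_id G F) (comp_functor_comp G F).

Record nat_trans (C D : category) (F G : functor C D) := NatTrans {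
  component :> forall X : C, hom (F X) (G X);
  naturality : forall (X Y : C) (f : hom X Y),
    component Y \oc fmap F f = fmap G f \oc component X
}.

Definition is_nat_iso (C D : category) (F G : functor C D)
    (s : nat_trans F G) : Prop := forall X : C, is_iso (s X).

Definition nat_isomorphic (C D : category) (F G : functor C D) : Prop :=
  exists s : nat_trans F G, is_nat_iso s.

Definition fully_faithful (C D : category) (F : functor C D) : Prop :=
  forall X Y : C, bijective (@fmap C D F X Y).

(* [adjunction F G]: F is left adjoint to G. *)
Record adjunction (C D : category) (F : functor C D) (G : functor D C) :=
  Adjunction {
    adj_unit : nat_trans (id_functor C) (comp_functor G F);
    adj_counit : nat_trans (comp_functor F G) (id_functor D);
    adj_triangle_left : forall X : C,
      adj_counit (F X) \oc fmap F (adj_unit X) = idc (F X);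
    adj_triangle_right : forall Y : D,
      fmap G (adj_counit Y) \oc adj_unit (G Y) = idc (G Y)
  }.

(* Triangulated categories in the sense of Verdier.  The shift is an additive
   autoequivalence with a chosen quasi-inverse, not necessarily a strict
   automorphism. *)
Record triangcat := TriangCat {
  tcat :> category;
  zero_ob : tcat;
  zero_obP : is_zero_ob zero_ob;
  biproductP : forall X Y : tcat,
    exists (P : tcat) (i1 : hom X P) (i2 : hom Y P)
           (p1 : hom P X) (p2 : hom P Y), is_biproduct i1 i2 p1 p2;
  shift : functor tcat tcat;
  unshift : functor tcat tcat;
  shift_additive : additive_functor shift;
  shiftK : nat_isomorphic (comp_functor unshift shift) (id_functor tcat);
  unshiftK : nat_isomorphic (comp_functor shift unshift) (id_functor tcat);
  (* [dist f g h]: X -f-> Y -g-> Z -h-> X[1] is a distinguished triangle *)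
  dist : forall X Y Z : tcat, hom X Y -> hom Y Z -> hom Z (shift X) -> Prop;
  TR1_iso : forall (X Y Z X' Y' Z' : tcat)
      (f : hom X Y) (g : hom Y Z) (h : hom Z (shift X))
      (f' : hom X' Y') (g' : hom Y' Z') (h' : hom Z' (shift X'))
      (a : hom X X') (b : hom Y Y') (c : hom Z Z'),
    is_iso a -> is_iso b -> is_iso c ->
    b \oc f = f' \oc a -> c \oc g = g' \oc b ->
    fmap shift a \oc h = h' \oc c ->
    dist f g h -> dist f' g' h';
  TR1_id : forall X : tcat,
    dist (idc X) (0 : hom X zero_ob) (0 : hom zero_ob (shift X));
  TR1_cone : forall (X Y : tcat) (f : hom X Y),
    exists (Z : tcat) (g : hom Y Z) (h : hom Z (shift X)), dist f g h;
  TR2 : forall (X Y Z : tcat)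
      (f : hom X Y) (g : hom Y Z) (h : hom Z (shift X)),
    dist f g h <-> dist g h (- fmap shift f);
  TR3 : forall (X Y Z X' Y' Z' : tcat)
      (f : hom X Y) (g : hom Y Z) (h : hom Z (shift X))
      (f' : hom X' Y') (g' : hom Y' Z') (h' : hom Z' (shift X'))
      (a : hom X X') (b : hom Y Y'),
    dist f g h -> dist f' g' h' -> b \oc f = f' \oc a ->
    exists c : hom Z Z',
      c \oc g = g' \oc b /\ fmap shift a \oc h = h' \oc c;
  (* octahedral axiom *)
  TR4 : forall (X Y Z X' Y' Z' : tcat) (f : hom X Y) (g : hom Y Z)
      (u1 : hom Y Z') (v1 : hom Z' (shift X))
      (u2 : hom Z X') (v2 : hom X' (shift Y))
      (u3 : hom Z Y') (v3 : hom Y' (shift X)),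
    dist f u1 v1 -> dist g u2 v2 -> dist (g \oc f) u3 v3 ->
    exists (a : hom Z' Y') (b : hom Y' X'),
      [/\ dist a b (fmap shift u1 \oc v2),
          a \oc u1 = u3 \oc g, v3 \oc a = v1,
          b \oc u3 = u2 & v2 \oc b = fmap shift f \oc v3]
}.
Arguments shift {t}.
Arguments unshift {t}.
Arguments dist {t X Y Z} f g h.

Definition triangulated (C D : triangcat) (F : functor C D) : Prop :=
  additive_functor F /\
  exists s : nat_trans (comp_functor F shift) (comp_functor shift F),
    is_nat_iso s /\
    forall (X Y Z : C) (f : hom X Y) (g : hom Y Z) (h : hom Z (shift X)),
      dist f g h -> dist (fmap F f) (fmap F g) (s X \oc fmap F h).

(* X[n], for n an integer; [Negz k] is -(k+1). *)
Definition shiftn (D : triangcat) (n : int) (X : D) : D :=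
  match n with
  | Posz k => iter k (@shift D) X
  | Negz k => iter k.+1 (@unshift D) X
  end.

(* Strictly full subcategories are given by their sets of objects; images of
   subcategories under functors are essential images. *)
Definition replete (D : category) (A : set D) : Prop :=
  forall X Y : D, X \iso Y -> A X -> A Y.

Definition ess_image (C D : category) (F : functor C D) (A : set C) : set D :=
  [set Y | exists2 X, A X & F X \iso Y].

Definition shift_set (D : triangcat) (A : set D) (n : int) : set D :=
  [set X | exists2 Y, A Y & shiftn n Y \iso X].

Record tpair (D : triangcat) := TPair { le0 : set D; ge0 : set D }.

Section TStructures.
Variable D : triangcat.
Implicit Types (t : tpair D) (n b : int).

Definition le t n : set D := shift_set (le0 t) (- n).
Definition ge t n : set D := shift_set (ge0 t) (- n).

Definition is_tstructure t : Prop :=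
  [/\ replete (le0 t) /\ replete (ge0 t),
      le0 t `<=` le t 1 /\ ge t 1 `<=` ge0 t,
      forall (X Y : D) (f : hom X Y), le0 t X -> ge t 1 Y -> f = 0
    & forall X : D, exists (A B : D) (f : hom A X) (g : hom X B)
        (h : hom B (shift A)), [/\ le0 t A, ge t 1 B & dist f g h]].

Definition heart t : set D := le0 t `&` ge0 t.
Definition dplus t : set D := \bigcup_(n : int) ge t n.
Definition dminus t : set D := \bigcup_(n : int) le t n.
Definition dbounded t : set D := dplus t `&` dminus t.

Definition bounded t : Prop := dbounded t = setT.

Definition tpair_of_connective (A : set D) : tpair D :=
  TPair A [set X | forall X', A X' -> forall f : hom (shift X') X, f = 0].

Definition right_amplitude_le t (Phi : functor D D) b : Prop :=
  forall X : D, le0 t X -> le t b (Phi X).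

Definition finite_right_amplitude t (Phi : functor D D) : Prop :=
  exists b : int, right_amplitude_le t Phi b.

Definition right_perverse t (Phi : functor D D) : tpair D :=
  tpair_of_connective [set X | le0 t X /\ le0 t (Phi X)].

(* Meant for idempotent triangulated endofunctors, such as the composite of a
   fully faithful triangulated functor with its right adjoint. *)
Definition right_t_exactable t (Phi : functor D D) : Prop :=
  is_tstructure (right_perverse t Phi).

End TStructures.

Section TExactness.
Variables C D : triangcat.

Definition right_t_exact (F : functor C D) (u : tpair C) (t : tpair D) :=
  triangulated F /\ forall X : C, le0 u X -> le0 t (F X).

Definition left_t_exact (F : functor C D) (u : tpair C) (t : tpair D) :=
  triangulated F /\ forall X : C, ge0 u X -> ge0 t (F X).

Definition t_exact (F : functor C D) (u : tpair C) (t : tpair D) :=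
  right_t_exact F u t /\ left_t_exact F u t.

Definition project (G : functor D C) (u : tpair D) : tpair C :=
  TPair (ess_image G (le0 u)) (ess_image G (ge0 u)).

Definition right_projects (G : functor D C) (u : tpair D) : Prop :=
  is_tstructure (project G u).

Definition conn_induced (F : functor C D) (t : tpair D) : tpair C :=
  tpair_of_connective [set X | le0 t (F X)].

Definition connectively_induces (F : functor C D) (t : tpair D) : Prop :=
  is_tstructure (conn_induced F t).

End TExactness.

(* Main.v *)
Require Import Defs.
From HB Require Import structures.
From mathcomp Require Import all_boot all_algebra.
From mathcomp Require Import boolp classical_sets.

Set Implicit Arguments.
Unset Strict Implicit.
Unset Printing Implicit Defensive.

(* The linear maps of vector spaces are also called [hom]; here [hom] must mean
   the hom-groups of a category. *)
Import Defs GRing.Theory Num.Theory.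
Local Open Scope ring_scope.

(** Write F for the embedding of C into D and G for its right adjoint, t for the
    given t-structure, P for the right perverse one and T for the induced pair
    on C.

    The connective parts are related by two inclusions: G sends P-connective
    objects to T-connective ones by the very definition of P, and F sends
    T-connective objects to P-connective ones because GF is isomorphic to the
    identity ([right_adjointK], [embedding_le0]).  By adjunction the second
    inclusion says that G sends P-coconnective objects to T-coconnective ones
    ([right_adjoint_ge0]).

    All the rest comes from one construction: take the P-truncation triangle
    A -> F X -> B of F X and apply G.  Since G F X is X, this is a triangle
    G A -> X -> G B whose ends lie in the right places, so it truncates X with
    respect to T, and T is a t-structure ([induced_tstructure]).  If X was
    already T-coconnective, then X is isomorphic to G B, although F X itself
    need not be P-coconnective; this shows that every T-coconnective object is
    the image of a P-coconnective one ([lift_ge0]).  Moreover B is a cone of a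
    map from a P-connective object to F X, so it inherits every upper bound of
    X that is at least the truncation degree: the lift of an object of the
    heart or of a bounded object is again such.

    The argument applies G to distinguished triangles, which is legitimate by
    the general fact that a right adjoint of a triangulated functor is
    triangulated ([right_adjoint_triangulated]).

    For boundedness, t-coconnective objects are P-coconnective, and when F G
    raises t-degrees by at most b, shifting a t-connective object by |b| makes
    it P-connective ([bounded_right_perverse]). *)

(** * Preadditive categories and functors *)

Section Preadditive.
Variable C : category.
Implicit Types X Y Z W : C.

Lemma comp0c X Y Z (f : hom X Y) : (0 : hom Y Z) \oc f = 0.
Proof. by apply: (addIr (0 \oc f)); rewrite -compDl !add0r. Qed.

Lemma compc0 X Y Z (g : hom Y Z) : g \oc (0 : hom X Y) = 0.
Proof. by apply: (addIr (g \oc 0)); rewrite -compDr !add0r. Qed.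

Lemma compNc X Y Z (g : hom Y Z) (f : hom X Y) : (- g) \oc f = - (g \oc f).
Proof. by apply: (addIr (g \oc f)); rewrite -compDl !addNr comp0c. Qed.

Lemma compcN X Y Z (g : hom Y Z) (f : hom X Y) : g \oc (- f) = - (g \oc f).
Proof. by apply: (addIr (g \oc f)); rewrite -compDr !addNr compc0. Qed.

Lemma compcB X Y Z (g : hom Y Z) (f1 f2 : hom X Y) :
  g \oc (f1 - f2) = g \oc f1 - g \oc f2.
Proof. by rewrite compDr compcN. Qed.

Lemma is_iso_id X : is_iso (idc X).
Proof. by exists (idc X); rewrite compc1. Qed.

Lemma isomorphic_refl X : X \iso X.
Proof. by exists (idc X); apply: is_iso_id. Qed.

Lemma isomorphic_sym X Y : X \iso Y -> Y \iso X.
Proof. by case=> f [g [gf fg]]; exists g; exists f. Qed.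

Lemma isomorphic_trans Y X Z : X \iso Y -> Y \iso Z -> X \iso Z.
Proof.
case=> f [f' [f'f ff']] [g [g' [g'g gg']]].
exists (g \oc f); exists (f' \oc g'); split.
  by rewrite -compA (compA g') g'g comp1c.
by rewrite -compA (compA f) ff' comp1c.
Qed.

(** The Yoneda criterion for isomorphisms: in a preadditive category it suffices
    that post-composition with f has trivial kernel and is onto. *)
Lemma is_iso_of_hom X Y (f : hom X Y) :
  (forall W (u : hom W X), f \oc u = 0 -> u = 0) ->
  (forall W (u : hom W Y), exists v : hom W X, u = f \oc v) ->
  is_iso f.
Proof.
move=> finj fsurj; have [r fr] := fsurj _ (idc Y).
exists r; split=> //; apply: subr0_eq; apply: finj.
by rewrite compcB compA -fr comp1c compc1 subrr.
Qed.

Definition hom_null X Y : Prop := forall f : hom X Y, f = 0.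

Lemma hom_null_iso X Y X' Y' :
  X \iso X' -> Y \iso Y' -> hom_null X Y -> hom_null X' Y'.
Proof.
move=> [a [a' [a'a aa']]] [b [b' [b'b bb']]] XY0 f.
rewrite -[f]comp1c -bb' -[f]compc1 -aa' -(compA b) (compA f) (compA b').
by rewrite (XY0 (b' \oc (f \oc a))) ?(compA b') comp0c compc0.
Qed.

End Preadditive.

Lemma fmap_iso (C D : category) (F : functor C D) (X Y : C) (f : hom X Y) :
  is_iso f -> is_iso (fmap F f).
Proof. by case=> g [gf fg]; exists (fmap F g); rewrite -!fmap_comp gf fg !fmap_id. Qed.

Lemma fob_iso (C D : category) (F : functor C D) (X Y : C) :
  X \iso Y -> F X \iso F Y.
Proof. by case=> f fI; exists (fmap F f); apply: fmap_iso. Qed.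

Lemma ff_inj (C D : category) (F : functor C D) (X Y : C) :
  fully_faithful F -> injective (@fmap _ _ F X Y).
Proof. by move=> Fff; apply: bij_inj. Qed.

Lemma ff_full (C D : category) (F : functor C D) (X Y : C)
  (g : hom (F X) (F Y)) : fully_faithful F -> exists f, fmap F f = g.
Proof. by move=> Fff; have [k _ kK] := Fff X Y; exists (k g). Qed.

Section Additive.
Variables (C D : category) (F : functor C D) (addF : additive_functor F).

Lemma fmap0 X Y : fmap F (0 : hom X Y) = 0.
Proof. by apply: (addIr (fmap F 0)); rewrite -addF !add0r. Qed.

End Additive.

(** * Adjoint functors *)

Section Adjunction.
Variables (C D : category) (F : functor C D) (G : functor D C).
Variable adj : adjunction F G.
Let eps := adj_counit adj.
Let eta := adj_unit adj.

Definition transpose X Y (u : hom X (G Y)) : hom (F X) Y := eps Y \oc fmap F u.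

(** The unit gives back u from its transpose, by one of the triangle
    identities; [transpose_surj] is the other one. *)
Lemma transpose_inj X Y : injective (@transpose X Y).
Proof.
have K (w : hom X (G Y)) : fmap G (transpose w) \oc eta X = w.
  rewrite fmap_comp -compA -(naturality eta w) compA.
  by rewrite (adj_triangle_right adj) comp1c.
by move=> u v uv; rewrite -(K u) uv K.
Qed.

Lemma transpose_surj X Y (w : hom (F X) Y) : exists u, transpose u = w.
Proof.
exists (fmap G w \oc eta X); rewrite /transpose fmap_comp compA.
rewrite (naturality eps w) -compA.
by rewrite (adj_triangle_left adj) compc1.
Qed.

Lemma transpose_precomp X X' Y (u : hom X (G Y)) (v : hom X' X) :
  transpose (u \oc v) = transpose u \oc fmap F v.
Proof. by rewrite /transpose fmap_comp compA. Qed.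

Lemma transpose_postcomp X Y Y' (g : hom Y Y') (u : hom X (G Y)) :
  transpose (fmap G g \oc u) = g \oc transpose u.
Proof. by rewrite /transpose fmap_comp !compA (naturality eps g). Qed.

Lemma transpose_id Y : transpose (idc (G Y)) = eps Y.
Proof. by rewrite /transpose fmap_id compc1. Qed.

(** By fullness the counit at F X is F r for some r; the two triangle identities
    then say that r is a two-sided inverse of the unit. *)
Lemma unit_iso X : fully_faithful F -> is_iso (eta X).
Proof.
move=> Fff; have [r Fr] := @ff_full _ _ F _ _ (eps (F X)) Fff.
exists r; split.
  apply: (ff_inj Fff); rewrite fmap_comp Fr fmap_id.
  exact: (adj_triangle_left adj).
apply: transpose_inj; rewrite transpose_precomp transpose_id Fr.
by rewrite /transpose (adj_triangle_left adj) comp1c.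
Qed.

Hypothesis addF : additive_functor F.

Lemma transpose0 X Y : transpose (0 : hom X (G Y)) = 0.
Proof. by rewrite /transpose fmap0 // compc0. Qed.

(** Transposition is additive because F is, and it turns G w into composition
    with w. *)
Lemma right_adjoint_additive : additive_functor G.
Proof.
move=> X Y f g; apply: transpose_inj.
have E (w : hom X Y) : transpose (fmap G w) = w \oc eps X.
  by rewrite -[fmap G w]compc1 transpose_postcomp transpose_id.
by rewrite E compDl -!E /transpose addF compDr.
Qed.

Lemma adj_hom_null X Y : hom_null (F X) Y -> hom_null X (G Y).
Proof. by move=> FXY0 u; apply: transpose_inj; rewrite transpose0; exact: FXY0. Qed.

End Adjunction.

(** * The shift and the long exact sequences *)

Section Shift.
Variable D : triangcat.
Implicit Types X Y Z W : D.

Lemma unshift_shift X : unshift (shift X) \iso X.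
Proof. have [s sI] := shiftK D; exists (s X); exact: sI. Qed.

Lemma shift_unshift X : shift (unshift X) \iso X.
Proof. have [s sI] := unshiftK D; exists (s X); exact: sI. Qed.

Lemma retract_faithful (A B : category) (F : functor A B) (G : functor B A)
    (X Y : A) : nat_isomorphic (comp_functor G F) (id_functor A) ->
  injective (@fmap _ _ F X Y).
Proof.
move=> [s sI] f g fg; have [t [_ st]] := sI X.
rewrite -[f]compc1 -[g]compc1 -st !compA.
by rewrite -!(naturality s (_ : hom X Y)) /= fg.
Qed.

Lemma shift_inj X Y : injective (@fmap _ _ (@shift D) X Y).
Proof. exact: retract_faithful (shiftK D). Qed.

(** A preimage of g is read off from the inverse shift of g.  It has the right
    image because the inverse shift is itself faithful. *)
Lemma shift_full X Y (g : hom (shift X) (shift Y)) :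
  exists f, fmap shift f = g.
Proof.
have [s sI] := shiftK D.
have [tX [tsX stX]] := sI X; have [tY [tsY stY]] := sI Y.
exists (s Y \oc fmap unshift g \oc tX).
apply: (retract_faithful (unshiftK D)).
have := naturality s (s Y \oc fmap unshift g \oc tX) => /=.
rewrite -(compA _ tX (s X)) tsX compc1 => /(congr1 (fun u => tY \oc u)).
by rewrite !(compA tY) tsY !comp1c.
Qed.

Lemma shift_iso_inj X Y : shift X \iso shift Y -> X \iso Y.
Proof.
move=> /(fob_iso unshift) XY.
apply: isomorphic_trans (isomorphic_sym (unshift_shift X)) _.
exact: isomorphic_trans XY (unshift_shift Y).
Qed.

Lemma hom_null_shift X Y : hom_null (shift X) (shift Y) <-> hom_null X Y.
Proof.
split=> XY0 f.
  by apply: shift_inj; rewrite (XY0 (fmap shift f)) fmap0 //; apply: shift_additive.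
have [g <-] := shift_full f.
by rewrite (XY0 g) fmap0 //; apply: shift_additive.
Qed.

Lemma hom_null_adj_shift X Y : hom_null (shift X) Y <-> hom_null X (unshift Y).
Proof.
split=> [XY0|/hom_null_shift XY0].
  apply/hom_null_shift; apply: hom_null_iso XY0; first exact: isomorphic_refl.
  exact: isomorphic_sym (shift_unshift Y).
by apply: hom_null_iso XY0; [apply: isomorphic_refl|apply: shift_unshift].
Qed.

Lemma shiftn_iso n X Y : X \iso Y -> shiftn n X \iso shiftn n Y.
Proof.
by case: n => k XY; elim: k => [|k IH] //=; apply: fob_iso.
Qed.

Lemma shiftn_succ n X : shiftn (n + 1) X \iso shift (shiftn n X).
Proof.
case: n => [k|[|k]].
- by rewrite -PoszD addn1; apply: isomorphic_refl.
- exact: isomorphic_sym (shift_unshift X).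
- have -> : Negz k.+1 + 1 = Negz k by rewrite !NegzE -(addn1 k.+1) PoszD opprD addrNK.
  exact: isomorphic_sym (shift_unshift _).
Qed.

(** By induction on n, in steps of one shift or one inverse shift; the two kinds
    of steps cancel only up to isomorphism, the shift being an
    autoequivalence. *)
Lemma shiftn_add n m X : shiftn (n + m) X \iso shiftn n (shiftn m X).
Proof.
case: n => k.
  elim: k => [|k IH]; first by rewrite add0r; apply: isomorphic_refl.
  have -> : Posz k.+1 + m = Posz k + m + 1 by rewrite -addn1 PoszD addrAC.
  apply: isomorphic_trans (shiftn_succ _ _) _.
  exact: (fob_iso shift) IH.
have H j Y : shiftn (j - 1) Y \iso unshift (shiftn j Y).
  apply: shift_iso_inj.
  apply: isomorphic_trans (isomorphic_sym (shift_unshift _)).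
  by apply: isomorphic_trans (isomorphic_sym (shiftn_succ _ _)) _;
    rewrite addrNK; apply: isomorphic_refl.
elim: k => [|k IH]; first by rewrite addrC; apply: H.
have -> : Negz k.+1 + m = Negz k + m - 1.
  by rewrite !NegzE -(addn1 k.+1) PoszD opprD addrAC.
apply: isomorphic_trans (H _ _) _.
exact: (fob_iso unshift) IH.
Qed.

Lemma shiftnK n X : shiftn (- n) (shiftn n X) \iso X.
Proof.
apply: isomorphic_trans (isomorphic_sym (shiftn_add _ _ _)) _.
by rewrite addNr; apply: isomorphic_refl.
Qed.

Lemma shiftnVK n X : shiftn n (shiftn (- n) X) \iso X.
Proof. by have := shiftnK (- n) X; rewrite opprK. Qed.

Lemma hom_null_shiftn n X Y : hom_null X Y -> hom_null (shiftn n X) (shiftn n Y).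
Proof.
move=> XY0; case: n => k; elim: k => [|k IH] //=; try by apply/hom_null_shift.
  apply/hom_null_adj_shift.
  by apply: hom_null_iso XY0; [apply: isomorphic_sym; apply: shift_unshift|apply: isomorphic_refl].
apply/hom_null_adj_shift.
by apply: hom_null_iso IH; [apply: isomorphic_sym; apply: shift_unshift|apply: isomorphic_refl].
Qed.

Lemma hom_null_adj_shiftn n X Y :
  hom_null (shiftn n X) Y <-> hom_null X (shiftn (- n) Y).
Proof.
split=> XY0.
  by apply: hom_null_iso (hom_null_shiftn (n := - n) XY0); 
    [apply: shiftnK|apply: isomorphic_refl].
by apply: hom_null_iso (hom_null_shiftn (n := n) XY0); 
  [apply: isomorphic_refl|apply: shiftnVK].
Qed.

Section Triangle.
Variables (X Y Z : D) (f : hom X Y) (g : hom Y Z) (h : hom Z (shift X)).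
Hypothesis dfgh : dist f g h.

Lemma dist_rot : dist g h (- fmap shift f).
Proof. exact: (proj1 (TR2 f g h) dfgh). Qed.

Lemma dist_comp0 : g \oc f = 0.
Proof.
have [c [c0 _]] := TR3 (a := idc X) (b := f) (TR1_id X) dfgh erefl.
by rewrite -c0 compc0.
Qed.

(** Exactness of Hom(W, -) at Hom(W, Y): a map u killed by g extends to a map to
    the rotated triangle from the rotation of W = W -> 0, and fullness of the
    shift brings its third component back to a map from W to X. *)
Lemma dist_lift W (u : hom W Y) : g \oc u = 0 -> exists v, u = f \oc v.
Proof.
move=> gu0; have dW := proj1 (TR2 _ _ _) (TR1_id W).
have [|c [_]] := TR3 (a := u) (b := 0 : hom (zero_ob D) Z) dW dist_rot.
  by rewrite gu0 comp0c.
have [v <-] := shift_full c.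
rewrite fmap_id compcN compc1 compNc -fmap_comp => /oppr_inj uv.
by exists v; apply: shift_inj.
Qed.

End Triangle.

Section TriangleExact.
Variables (X Y Z : D) (f : hom X Y) (g : hom Y Z) (h : hom Z (shift X)).
Hypothesis dfgh : dist f g h.

Lemma dist_lift2 W (u : hom W Z) : h \oc u = 0 -> exists v, u = g \oc v.
Proof. exact: (dist_lift (dist_rot dfgh)). Qed.

Lemma dist_lift3 W (u : hom W (shift X)) :
  fmap shift f \oc u = 0 -> exists v, u = h \oc v.
Proof.
move=> fu0; apply: (dist_lift (dist_rot (dist_rot dfgh))).
by rewrite compNc fu0 oppr0.
Qed.

Lemma dist_shift_comp0 : fmap shift f \oc h = 0.
Proof.
apply: oppr_inj; rewrite -compNc oppr0.
exact: (dist_comp0 (dist_rot (dist_rot dfgh))).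
Qed.

(** Exactness of Hom(-, W) at Hom(Y, W).  A map of triangles can only be
    completed at its third vertex, so the trivial triangle on W is rotated twice
    to 0 -> W[1] = W[1], and the given one three times to match. *)
Lemma dist_extend W (u : hom Y W) : u \oc f = 0 -> exists v, u = v \oc g.
Proof.
move=> uf0; have dW := dist_rot (dist_rot (TR1_id W)).
have dS := dist_rot (dist_rot (dist_rot dfgh)).
have [|c []] := TR3 (a := 0 : hom (shift X) (zero_ob D)) (b := fmap shift u) dS dW.
  by rewrite compcN -fmap_comp uf0 fmap0 ?compc0 ?oppr0 //; apply: shift_additive.
have [v <-] := shift_full c.
rewrite fmap_id compNc comp1c compcN -fmap_comp => /oppr_inj uv _.
by exists v; apply: shift_inj.
Qed.

Lemma dist_iso2 : f = 0 -> h = 0 -> is_iso g.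
Proof.
move=> f0 h0; apply: is_iso_of_hom => W u.
  by move=> /(dist_lift dfgh) [v ->]; rewrite f0 comp0c.
by apply: dist_lift2; rewrite h0 comp0c.
Qed.

End TriangleExact.

Lemma dist_iso1 X Y Z (f : hom X Y) (g : hom Y Z) (h : hom Z (shift X)) :
  dist f g h -> g = 0 -> h = 0 -> is_iso f.
Proof.
move=> dfgh g0 h0; apply: is_iso_of_hom => W u.
  move=> fu0; apply: shift_inj; rewrite fmap0; last exact: shift_additive.
  have [|v ->] := dist_lift3 dfgh (u := fmap shift u).
    by rewrite -fmap_comp fu0 fmap0 //; apply: shift_additive.
  by rewrite h0 comp0c.
by apply: (dist_lift dfgh); rewrite g0 comp0c.
Qed.

End Shift.

Section TriangulatedFunctor.
Variables (C D : triangcat) (F : functor C D) (triF : triangulated F).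

Lemma triangulated_shift X : F (shift X) \iso shift (F X).
Proof. have [_ [s [sI _]]] := triF; exists (s X); exact: sI. Qed.

Lemma triangulated_unshift X : F (unshift X) \iso unshift (F X).
Proof.
apply: shift_iso_inj.
apply: isomorphic_trans (isomorphic_sym (triangulated_shift _)) _.
apply: isomorphic_trans (fob_iso F (shift_unshift X)) _.
exact: isomorphic_sym (shift_unshift _).
Qed.

Lemma triangulated_shiftn n X : F (shiftn n X) \iso shiftn n (F X).
Proof.
case: n => k; elim: k => [|k IH] /=; first exact: isomorphic_refl.
- apply: isomorphic_trans (triangulated_shift _) _; exact: (fob_iso shift).
- exact: triangulated_unshift.
- apply: isomorphic_trans (triangulated_unshift _) _; exact: (fob_iso unshift).
Qed.

End TriangulatedFunctor.

(** * The right adjoint of a triangulated functor is triangulated *)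

Section TriangulatedAdjoint.
Variables (C D : triangcat) (F : functor C D) (G : functor D C).
Variables (adj : adjunction F G) (triF : triangulated F).
Let addF : additive_functor F := proj1 triF.

(** The comparison t : (G X)[1] -> G (X[1]) is the transpose of the shifted
    counit.  It is invertible because post-composing with t amounts, through
    the adjunction and the shift, to a bijection on maps out of any W'[1], and
    every object is of this form.  For a triangle X -> Y -> Z, let K be a cone
    of G f.  The counits of X and Y extend to a map F K -> Z, whose transpose
    c : K -> G Z is an isomorphism by the five lemma: Hom(W, -) makes the
    triangle of K exact, and Hom(W, G -) = Hom(F W, -) makes the image of the
    given triangle exact. *)
Lemma right_adjoint_triangulated : triangulated G.
Proof.
have addG : additive_functor G := right_adjoint_additive adj addF.
split=> //.
have [_ [s [sI sD]]] := triF.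
have [t tE] : exists t : forall X, hom (shift (G X)) (G (shift X)),
    forall X, transpose adj (t X) = fmap shift (adj_counit adj X) \oc s (G X).
  have tX X := cid (transpose_surj adj (fmap shift (adj_counit adj X) \oc s (G X))).
  by exists (fun X => sval (tX X)) => X; case: (tX X).
have tV X W (v : hom W (G X)) :
    transpose adj (t X \oc fmap shift v) = fmap shift (transpose adj v) \oc s W.
  rewrite transpose_precomp tE -compA (naturality s v) compA /=.
  by rewrite -fmap_comp.
have t_nat X Y (f : hom X Y) :
    t Y \oc fmap shift (fmap G f) = fmap G (fmap shift f) \oc t X.
  apply: (transpose_inj (adj := adj)).
  rewrite tV transpose_postcomp tE compA -fmap_comp.
  by rewrite -[fmap G f]compc1 transpose_postcomp transpose_id.
have t_iso X : is_iso (t X).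
  apply: is_iso_of_hom => W u.
    have [e [e' [e'e ee']]] := shift_unshift W.
    have [v ve] := shift_full (u \oc e).
    move=> tu0; rewrite -[u]compc1 -ee' compA -ve.
    suff -> : v = 0 by rewrite fmap0 ?comp0c //; apply: shift_additive.
    apply: (transpose_inj (adj := adj)); rewrite transpose0 //.
    apply: shift_inj; rewrite fmap0; last exact: shift_additive.
    have [s' [_ ss']] := sI (unshift W).
    rewrite -[LHS]compc1 -ss' compA -tV ve compA tu0 comp0c.
    by rewrite transpose0 // comp0c.
  have [e [e' [e'e ee']]] := shift_unshift W.
  have [s' [s's _]] := sI (unshift W).
  have [y ye] := shift_full (transpose adj (u \oc e) \oc s').
  have [v vy] := transpose_surj adj y.
  exists (fmap shift v \oc e').
  rewrite compA -[u]compc1 -ee' compA; congr (_ \oc _).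
  apply: (transpose_inj (adj := adj)); rewrite tV vy ye -compA s's.
  by rewrite compc1.
have [r rE] : exists r : forall X, hom (G (shift X)) (shift (G X)),
    forall X, r X \oc t X = idc _ /\ t X \oc r X = idc _.
  by exists (fun X => sval (cid (t_iso X))) => X; case: cid.
have r_nat X Y (f : hom X Y) :
    r Y \oc fmap G (fmap shift f) = fmap shift (fmap G f) \oc r X.
  rewrite -[fmap G _]compc1 -(rE X).2 (compA (fmap G _)) -t_nat.
  by rewrite !compA (rE Y).1 comp1c.
pose rho : nat_trans (comp_functor G shift) (comp_functor shift G) :=
  NatTrans (F := comp_functor G shift) (G := comp_functor shift G) r_nat.
exists rho; split=> [X|X Y Z f g h dfgh].
  by exists (t X); case: (rE X).
rewrite -[rho X]/(r X).
have [K [k [l dK]]] := TR1_cone (fmap G f).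
have [|w [wk wl]] := TR3 (a := adj_counit adj X) (b := adj_counit adj Y)
                        (sD _ _ _ _ _ _ dK) dfgh.
  exact: (naturality (adj_counit adj) f).
have [c cw] := transpose_surj adj w.
have ck : c \oc k = fmap G g.
  apply: (transpose_inj (adj := adj)); rewrite transpose_precomp cw wk.
  by rewrite -[fmap G g]compc1 transpose_postcomp transpose_id.
have cl : r X \oc fmap G h \oc c = l.
  rewrite -compA; suff <- : t X \oc l = fmap G h \oc c.
    by rewrite compA (rE X).1 comp1c.
  apply: (transpose_inj (adj := adj)).
  by rewrite transpose_precomp tE -compA wl transpose_postcomp cw.
have c_iso : is_iso c.
  apply: is_iso_of_hom => W u.
    (* u comes from G Y, and from G X after transposing; it dies in K *)
    move=> cu0; have [|v uE] := dist_lift2 dK (u := u).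
      by rewrite -cl -compA cu0 compc0.
    have [|y yE] := dist_lift dfgh (u := transpose adj v).
      by rewrite -transpose_postcomp -ck -compA -uE cu0 transpose0.
    have [v' v'y] := transpose_surj adj y.
    have vE : v = fmap G f \oc v'.
      by apply: (transpose_inj (adj := adj)); rewrite transpose_postcomp v'y.
    by rewrite uE vE compA (dist_comp0 dK) comp0c.
  (* v has the same boundary as u, so u - c v comes from G Y *)
  have [|v vE] := dist_lift3 dK (u := r X \oc fmap G h \oc u).
    rewrite !compA -r_nat -(compA (r Y)) -fmap_comp (dist_shift_comp0 dfgh).
    by rewrite fmap0 // compc0 comp0c.
  have [|y yE] := dist_lift2 dfgh (u := transpose adj (u - c \oc v)).
    rewrite -transpose_postcomp.
    suff -> : fmap G h \oc (u - c \oc v) = 0 by rewrite transpose0.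
    rewrite -[fmap G h]comp1c -(rE X).2 -!compA !(compA (r X)) compcB.
    by rewrite vE compA cl subrr compc0.
  have [v' v'y] := transpose_surj adj y.
  have uE : u - c \oc v = c \oc (k \oc v').
    by apply: (transpose_inj (adj := adj));
       rewrite compA ck transpose_postcomp v'y.
  by exists (v + k \oc v'); rewrite compDr -uE addrC subrK.
apply: (TR1_iso (a := idc _) (b := idc _) (c := c)) dK => //;
  try exact: is_iso_id.
- by rewrite comp1c compc1.
- by rewrite compc1.
- by rewrite fmap_id comp1c.
Qed.

End TriangulatedAdjoint.

(** * t-structures *)

Lemma shift_setE (D : triangcat) (A : set D) n X :
  replete A -> shift_set A (- n) X <-> A (shiftn n X).
Proof.
move=> repA; split=> [[Y AY YX]|AX]; last by exists (shiftn n X) => //; apply: shiftnK.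
apply: repA AY; apply: isomorphic_trans (shiftn_iso n YX).
exact: isomorphic_sym (shiftnVK n Y).
Qed.

Section TStructure.
Variables (D : triangcat) (t : tpair D).
Hypothesis t_tstr : is_tstructure t.
Implicit Types X Y Z A B : D.

Lemma le0_replete : replete (le0 t).
Proof. by have [[]] := t_tstr. Qed.

Lemma ge0_replete : replete (ge0 t).
Proof. by have [[]] := t_tstr. Qed.

Lemma leE n X : le t n X <-> le0 t (shiftn n X).
Proof. exact/shift_setE/le0_replete. Qed.

Lemma geE n X : ge t n X <-> ge0 t (shiftn n X).
Proof. exact/shift_setE/ge0_replete. Qed.

Lemma dplusE X : dplus t X <-> exists n, ge0 t (shiftn n X).
Proof. by split=> [[n _ /geE]|[n /geE]]; exists n. Qed.

Lemma dminusE X : dminus t X <-> exists n, le0 t (shiftn n X).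
Proof. by split=> [[n _ /leE]|[n /leE]]; exists n. Qed.

Lemma dplus_replete : replete (dplus t).
Proof.
move=> X Y XY /dplusE [n ge0X]; apply/dplusE; exists n.
exact: ge0_replete (shiftn_iso n XY) ge0X.
Qed.

Lemma dminus_replete : replete (dminus t).
Proof.
move=> X Y XY /dminusE [n le0X]; apply/dminusE; exists n.
exact: le0_replete (shiftn_iso n XY) le0X.
Qed.

Lemma le0_shift X : le0 t X -> le0 t (shift X).
Proof. by have [_ [le01 _] _ _] := t_tstr => /le01 /leE. Qed.

Lemma le0_shiftn_mono n m X :
  n <= m -> le0 t (shiftn n X) -> le0 t (shiftn m X).
Proof.
rewrite -subr_ge0 => nm le0X; rewrite -(subrK n m) -(gez0_abs nm).
apply: le0_replete (isomorphic_sym (shiftn_add _ _ _)) _.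
by elim: `|m - n|%N => //= k; apply: le0_shift.
Qed.

Lemma hom_null_le0_ge1 X Y : le0 t X -> ge t 1 Y -> hom_null X Y.
Proof. by have [_ _ orth _] := t_tstr => le0X ge1Y f; apply: orth. Qed.

Lemma hom_null_le0_ge0 X Y : le0 t X -> ge0 t Y -> hom_null (shift X) Y.
Proof.
move=> le0X ge0Y; apply/hom_null_adj_shift/hom_null_le0_ge1 => //.
by apply/geE; apply: ge0_replete (isomorphic_sym (shift_unshift Y)) _.
Qed.

(** Truncate X as A -> X -> B: the second map vanishes by assumption, so the
    identity of B factors through A[1], which has no nonzero map to B.  Hence B
    is zero and A is isomorphic to X. *)
Lemma le0_of_hom_null X : (forall Y, ge t 1 Y -> hom_null X Y) -> le0 t X.
Proof.
move=> X0; have [_ _ _ /(_ X) [A [B [f [g [h [le0A ge1B dfgh]]]]]]] := t_tstr.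
suff fI : is_iso f by apply: le0_replete le0A; exists f.
have g0 : g = 0 by apply: X0.
have [|v vh] := dist_extend (dist_rot dfgh) (u := idc B).
  by rewrite g0 compc0.
have v0 : v = 0 by apply: hom_null_le0_ge1; [apply: le0_shift|].
apply: dist_iso1 dfgh g0 _.
by rewrite -[h]compc1 vh v0 comp0c compc0.
Qed.

Section Cone.
Variables (X Y Z : D) (f : hom X Y) (g : hom Y Z) (h : hom Z (shift X)).
Hypothesis dfgh : dist f g h.

(** Being connective is tested by maps to coconnective objects, and a map out of
    Z that vanishes on Y factors through X[1]. *)
Lemma le0_cone n :
  le0 t (shiftn n (shift X)) -> le0 t (shiftn n Y) -> le0 t (shiftn n Z).
Proof.
move=> leX leY; apply: le0_of_hom_null => W ge1W; apply/hom_null_adj_shiftn => u.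
have nullX : hom_null (shift X) (shiftn (- n) W).
  exact/hom_null_adj_shiftn/hom_null_le0_ge1.
have nullY : hom_null Y (shiftn (- n) W).
  exact/hom_null_adj_shiftn/hom_null_le0_ge1.
have [|v ->] := dist_extend (dist_rot dfgh) (u := u); first exact: nullY.
by rewrite (nullX v) comp0c.
Qed.

(** An object of degree >= 1 is its own truncation: f is zero, hence the
    identity of X[1] factors through Z and vanishes, which kills h as well. *)
Lemma is_iso_truncation_ge1 : le0 t X -> ge t 1 Y -> ge t 1 Z -> is_iso g.
Proof.
move=> le0X ge1Y ge1Z; have f0 : f = 0 by apply: hom_null_le0_ge1.
apply: (dist_iso2 dfgh) => //.
have [|v vE] := dist_lift3 dfgh (u := idc (shift X)).
  by rewrite f0 fmap0 ?comp0c //; apply: shift_additive.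
have v0 : v = 0 by apply: hom_null_le0_ge1; [apply: le0_shift|].
by rewrite -[h]comp1c vE v0 compc0 comp0c.
Qed.

End Cone.

End TStructure.

Section TPairOfConnective.
Variables (D : triangcat) (A : set D).
Hypothesis A_replete : replete A.
Let t := tpair_of_connective A.

Lemma ge0_of_connective_replete : replete (ge0 t).
Proof.
move=> X Y XY ge0X Z AZ.
by apply: hom_null_iso (ge0X Z AZ); [apply: isomorphic_refl|].
Qed.

Lemma ge1_of_connectiveE X : ge t 1 X <-> forall Y, A Y -> hom_null Y X.
Proof.
apply: iff_trans (shift_setE 1 X ge0_of_connective_replete) _.
by split=> ge1X Y AY; apply/hom_null_shift; apply: ge1X.
Qed.

(** Since the coconnective part is defined by orthogonality, only stability under
    the shift and the existence of truncations remain to be checked. *)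
Lemma is_tstructure_of_connective :
  (forall X, A X -> A (shift X)) ->
  (forall X, exists (X0 X1 : D) (f : hom X0 X) (g : hom X X1)
     (h : hom X1 (shift X0)), [/\ A X0, ge t 1 X1 & dist f g h]) ->
  is_tstructure t.
Proof.
move=> A_shift trunc; split=> //.
- by split=> //; apply: ge0_of_connective_replete.
- split=> X; first by move=> AX; apply/(shift_setE 1 X A_replete)/A_shift.
  by move=> /ge1_of_connectiveE ge1X Y AY; apply/ge1X/A_shift.
- by move=> X Y f AX /ge1_of_connectiveE ge1Y; apply: ge1Y.
Qed.

End TPairOfConnective.

(** * Projecting the perverse t-structure to the subcategory *)

Section Perverse.
Variables (D : triangcat) (tau : tpair D) (tau_t : is_tstructure tau).
Variables (C : triangcat) (F : functor C D) (triF : triangulated F).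
Hypothesis Fff : fully_faithful F.
Variables (G : functor D C) (adj : adjunction F G).
Let tauP := right_perverse tau (comp_functor F G).
Let tauC := conn_induced F tau.
Hypothesis tauP_t : is_tstructure tauP.

Let addF : additive_functor F := proj1 triF.
Let triG : triangulated G := right_adjoint_triangulated adj triF.

Lemma right_adjointK X : G (F X) \iso X.
Proof.
by apply: isomorphic_sym; exists (adj_unit adj X); apply: unit_iso.
Qed.

Lemma right_adjoint_le0 Y : le0 tauP Y -> le0 tauC (G Y).
Proof. by case. Qed.

Lemma embedding_le0 X : le0 tauC X -> le0 tauP (F X).
Proof.
move=> le0X; split=> //; apply: (le0_replete tau_t) le0X.
exact: (fob_iso F) (isomorphic_sym (right_adjointK X)).
Qed.

Lemma right_adjoint_ge0 Y : ge0 tauP Y -> ge0 tauC (G Y).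
Proof.
move=> ge0Y X le0X; apply: (adj_hom_null adj addF).
apply: hom_null_iso (ge0Y _ (embedding_le0 le0X)); last exact: isomorphic_refl.
exact: isomorphic_sym (triangulated_shift triF X).
Qed.

Lemma induced_le0_replete : replete (le0 tauC).
Proof.
by move=> X Y XY; apply: (le0_replete tau_t); apply: fob_iso XY.
Qed.

Lemma right_adjoint_ge1 Y : ge tauP 1 Y -> ge tauC 1 (G Y).
Proof.
move=> /(geE tauP_t) /right_adjoint_ge0 ge0GY.
apply/shift_setE; first exact: ge0_of_connective_replete.
apply: ge0_of_connective_replete ge0GY.
exact: triangulated_shift triG Y.
Qed.

(** The truncation of X is the image under G of the truncation of F X, once G F X
    is replaced by X. *)
Lemma induced_tstructure : is_tstructure tauC.
Proof.
apply: is_tstructure_of_connective => [|X le0X|X]; first exact: induced_le0_replete.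
  apply: (le0_replete tau_t) (isomorphic_sym (triangulated_shift triF X)) _.
  exact: (le0_shift tau_t).
have [_ _ _ /(_ (F X)) [A [B [f [g [h [le0A ge1B dfgh]]]]]]] := tauP_t.
have [_ [s [_ /(_ _ _ _ _ _ _ dfgh) dG]]] := triG.
have [e [e' [e'e ee']]] := right_adjointK X.
exists (G A), (G B), (e \oc fmap G f), (fmap G g \oc e'), (s A \oc fmap G h).
split; [exact: right_adjoint_le0|exact: right_adjoint_ge1|].
apply: (TR1_iso (a := idc _) (b := e) (c := idc _)) dG; try exact: is_iso_id.
- by exists e'.
- by rewrite compc1.
- by rewrite comp1c -compA e'e compc1.
- by rewrite fmap_id comp1c compc1.
Qed.

Let tauC_t := induced_tstructure.

(** The lift is the upper truncation of F X rather than F X, which need not be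
    P-coconnective.  The last clause records that truncating does not spoil
    upper bounds; n is a natural number because the removed part is only known to
    be connective. *)
Lemma lift_ge1 X : ge tauC 1 X ->
  exists Y, [/\ ge tauP 1 Y, G Y \iso X &
    forall n : nat, le0 tauC (shiftn n X) -> le0 tauP (shiftn n Y)].
Proof.
move=> ge1X.
have [_ _ _ /(_ (F X)) [A [B [f [g [h [le0A ge1B dfgh]]]]]]] := tauP_t.
have [_ [s [_ /(_ _ _ _ _ _ _ dfgh) dG]]] := triG.
have ge1GFX : ge tauC 1 (G (F X)).
  apply/(geE tauC_t); move/(geE tauC_t): ge1X; apply: (ge0_replete tauC_t).
  exact: shiftn_iso (isomorphic_sym (right_adjointK X)).
have gI : is_iso (fmap G g).
  apply: (is_iso_truncation_ge1 tauC_t dG) => //; first exact: right_adjoint_le0.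
  exact: right_adjoint_ge1.
exists B; split=> // [|n le0X].
  apply: isomorphic_trans (right_adjointK X).
  by apply: isomorphic_sym; exists (fmap G g).
apply: (le0_cone tauP_t dfgh).
  by elim: {le0X} n => /= [|n]; apply: (le0_shift tauP_t).
apply: (le0_replete tauP_t) (triangulated_shiftn triF n X) _.
exact: embedding_le0.
Qed.

Lemma lift_ge0 X : ge0 tauC X ->
  exists Y, [/\ ge0 tauP Y, G Y \iso X &
    forall n : nat, le0 tauC (shiftn n X) -> le0 tauP (shiftn n Y)].
Proof.
move=> ge0X; have XE := shift_unshift X.
have [|Y [/(geE tauP_t) ge0Y GY leY]] := lift_ge1 (X := unshift X).
  by apply/(geE tauC_t); apply: (ge0_replete tauC_t) (isomorphic_sym XE) _.
exists (shift Y); split=> // [|n leX].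
  apply: isomorphic_trans (triangulated_shift triG Y) _.
  exact: isomorphic_trans (fob_iso shift GY) XE.
apply: (le0_replete tauP_t) (shiftn_add n 1 Y) _.
rewrite -PoszD; apply: leY; rewrite PoszD.
apply: (le0_replete tauC_t) (isomorphic_sym (shiftn_add n 1 _)) _.
exact: (le0_replete tauC_t) (shiftn_iso n (isomorphic_sym XE)) leX.
Qed.

(** A lift that is bounded on both sides as soon as X is, so that it serves for
    objects bounded below and for bounded objects. *)
Lemma lift_dplus X : dplus tauC X ->
  exists Y, [/\ dplus tauP Y, G Y \iso X & dminus tauC X -> dminus tauP Y].
Proof.
case/(dplusE tauC_t) => a /lift_ge0 [Y [ge0Y GY leY]].
have aE := shiftnVK a Y.
exists (shiftn (- a) Y); split.
- apply/(dplusE tauP_t); exists a.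
  exact: (ge0_replete tauP_t) (isomorphic_sym aE) ge0Y.
- apply: isomorphic_trans (triangulated_shiftn triG _ _) _.
  exact: isomorphic_trans (shiftn_iso (- a) GY) (shiftnK a X).
- case/(dminusE tauC_t) => b leX; apply/(dminusE tauP_t).
  (* any natural number n with n + a >= b bounds the lift of X[a] *)
  exists (`|b - a|%N%:Z + a).
  apply: (le0_replete tauP_t) (isomorphic_sym (shiftn_add _ _ _)) _.
  apply: (le0_replete tauP_t) (shiftn_iso _ (isomorphic_sym aE)) _.
  apply: leY; apply: (le0_replete tauC_t) (shiftn_add _ _ _) _.
  apply: (le0_shiftn_mono tauC_t) leX.
  by rewrite -lerBlDr abszE ler_norm.
Qed.

Lemma right_adjoint_dplus Y : dplus tauP Y -> dplus tauC (G Y).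
Proof.
case/(dplusE tauP_t) => n /right_adjoint_ge0 leY; apply/(dplusE tauC_t).
by exists n; apply: (ge0_replete tauC_t) leY; apply: triangulated_shiftn.
Qed.

Lemma right_adjoint_dminus Y : dminus tauP Y -> dminus tauC (G Y).
Proof.
case/(dminusE tauP_t) => n /right_adjoint_le0 leY; apply/(dminusE tauC_t).
by exists n; apply: (le0_replete tauC_t) leY; apply: triangulated_shiftn.
Qed.

Lemma embedding_dminus X : dminus tauC X -> dminus tauP (F X).
Proof.
case/(dminusE tauC_t) => n /embedding_le0 leX; apply/(dminusE tauP_t).
by exists n; apply: (le0_replete tauP_t) leX; apply: triangulated_shiftn.
Qed.

Lemma le0_induced_image : le0 tauC = ess_image G (le0 tauP).
Proof.
apply/predeqP => X; split=> [le0X|[Y le0Y GY]].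
  by exists (F X); [apply: embedding_le0|apply: right_adjointK].
exact: (le0_replete tauC_t) GY (right_adjoint_le0 le0Y).
Qed.

Lemma ge0_induced_image : ge0 tauC = ess_image G (ge0 tauP).
Proof.
apply/predeqP => X; split=> [/lift_ge0 [Y [ge0Y GY _]]|[Y ge0Y GY]].
  by exists Y.
exact: (ge0_replete tauC_t) GY (right_adjoint_ge0 ge0Y).
Qed.

Lemma heart_induced_image : heart tauC = ess_image G (heart tauP).
Proof.
apply/predeqP => X; split=> [[le0X /lift_ge0 [Y [ge0Y GY leY]]]|[Y [le0Y ge0Y] GY]].
  by exists Y => //; split=> //; apply: (leY 0).
split; first exact: (le0_replete tauC_t) GY (right_adjoint_le0 le0Y).
exact: (ge0_replete tauC_t) GY (right_adjoint_ge0 ge0Y).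
Qed.

Lemma dplus_induced_image : dplus tauC = ess_image G (dplus tauP).
Proof.
apply/predeqP => X; split=> [/lift_dplus [Y [plusY GY _]]|[Y plusY GY]].
  by exists Y.
exact: (dplus_replete tauC_t) GY (right_adjoint_dplus plusY).
Qed.

Lemma dminus_induced_image : dminus tauC = ess_image G (dminus tauP).
Proof.
apply/predeqP => X; split=> [minusX|[Y minusY GY]].
  by exists (F X); [apply: embedding_dminus|apply: right_adjointK].
exact: (dminus_replete tauC_t) GY (right_adjoint_dminus minusY).
Qed.

Lemma dbounded_induced_image : dbounded tauC = ess_image G (dbounded tauP).
Proof.
apply/predeqP => X; split=> [[/lift_dplus [Y [plusY GY minusY]] minusX]|[Y [plusY minusY] GY]].
  by exists Y => //; split=> //; apply: minusY.
split; first exact: (dplus_replete tauC_t) GY (right_adjoint_dplus plusY).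
exact: (dminus_replete tauC_t) GY (right_adjoint_dminus minusY).
Qed.

(** The lower bound for tau passes to tauP since the latter has fewer connective
    objects.  For the upper bound, shifting by |b| serves whatever the sign of
    b: the object stays connective because |b| >= 0, and its image under F G
    becomes so because |b| >= b. *)
Lemma bounded_right_perverse :
  bounded tau -> finite_right_amplitude tau (comp_functor F G) -> bounded tauP.
Proof.
move=> tau_b [b amp]; apply/predeqP => X; split=> // _.
have [/(dplusE tau_t) [m geX] /(dminusE tau_t) [n leX]] : dbounded tau X.
  by rewrite tau_b.
split.
  apply/(dplusE tauP_t); exists m => Y [le0Y _].
  exact: (hom_null_le0_ge0 tau_t).
apply/(dminusE tauP_t); exists (`|b|%N%:Z + n).
apply: (le0_replete tauP_t) (isomorphic_sym (shiftn_add _ _ _)) _.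
split; first by apply: (le0_shiftn_mono tau_t (n := 0)) leX.
have /(leE tau_t) leFGX := amp _ leX.
apply: (le0_replete tau_t) (isomorphic_sym _)
  (le0_shiftn_mono tau_t (m := `|b|%N) _ leFGX); last by rewrite abszE ler_norm.
apply: isomorphic_trans (fob_iso F (triangulated_shiftn triG _ _)) _.
exact: triangulated_shiftn.
Qed.

End Perverse.

Theorem theorem5p15
  (D : triangcat) (tau : tpair D) (tau_t : is_tstructure tau)
  (C : triangcat) (gamma : functor C D)
  (gamma_triang : triangulated gamma) (gamma_ff : fully_faithful gamma)
  (gammaR : functor D C) (gamma_adj : adjunction gamma gammaR)
  (gammaR_exactable :
     right_t_exactable tau (comp_functor gamma gammaR)) :
  let tauP := right_perverse tau (comp_functor gamma gammaR) in
  let tauC := conn_induced gamma tau in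
  connectively_induces gamma tau /\
  (* (1) *)
  (right_projects gammaR tauP /\ project gammaR tauP = tauC) /\
  (* (2) *)
  (heart tauC = ess_image gammaR (heart tauP) /\
   dplus tauC = ess_image gammaR (dplus tauP) /\
   dminus tauC = ess_image gammaR (dminus tauP) /\
   dbounded tauC = ess_image gammaR (dbounded tauP)) /\
  (* (3) *)
  t_exact gammaR tauP tauC /\
  (* (4) *)
  right_t_exact gamma tauC tauP /\
  (* (5) *)
  (bounded tau ->
   finite_right_amplitude tau (comp_functor gamma gammaR) ->
   bounded tauP /\ bounded tauC).
Proof.
move=> tauP tauC; have tauP_t : is_tstructure tauP := gammaR_exactable.
have tauC_t : is_tstructure tauC.
  exact: (induced_tstructure tau_t gamma_triang gamma_ff gamma_adj).
have triR := right_adjoint_triangulated gamma_adj gamma_triang.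
have projE : project gammaR tauP = tauC.
  rewrite /project.
  rewrite -(le0_induced_image tau_t gamma_triang gamma_ff gamma_adj tauP_t).
  by rewrite -(ge0_induced_image tau_t gamma_triang gamma_ff gamma_adj tauP_t).
have dboundedE : dbounded tauC = ess_image gammaR (dbounded tauP).
  exact: dbounded_induced_image gamma_adj tauP_t.
split=> //; split; first by rewrite /right_projects projE.
split; first split.
- exact: heart_induced_image gamma_adj tauP_t.
- split; first exact: dplus_induced_image gamma_adj tauP_t.
  by split=> //; apply: dminus_induced_image gamma_adj tauP_t.
split; first split.
- by split=> // X; apply: right_adjoint_le0.
- by split=> // X; apply: (right_adjoint_ge0 tau_t gamma_triang gamma_ff gamma_adj).
split; first by split=> // X; apply: (embedding_le0 tau_t gamma_ff gamma_adj).
move=> tau_b amp.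
have tauP_b : bounded tauP by apply: bounded_right_perverse amp.
split=> //; rewrite /bounded dboundedE; apply/predeqP => X; split=> // _.
by exists (gamma X); [rewrite tauP_b|exact: (right_adjointK gamma_ff gamma_adj)].
Qed.
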